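(* Let $d\ge 2$, let $A_1,\dots,A_d\subset\{0,\dots,L-1\}$ be digit sets with $\prod_i\#A_i=L$, let $\theta\in\mathbb S^{d-1}$, $N\geq1$, and let $f_n=f_{n,\theta}$ ($1\le n\le N$) and $f_N^*=\max_{1\leq n\leq N}f_n$ be the associated counting functions. Let $\rho>2$. Suppose that $$\mu(K):=\mathcal H^1\big(\{x\in\mathbb R:f_N^*(x)\geq K\}\big)\leq K^{-\rho}.$$ Then, for all sufficiently large $K$ (with threshold depending only on $L,d,\rho$), one has $$\|f_N^*\|_{L^2(\mathbb R)}^2\leq C_{L,d,\rho}\,K,$$ where $C_{L,d,\rho}$ depends only on $L,d,\rho$. Consequently, $$\max_{1\leq n\leq N}\|f_n\|_{L^2(\mathbb R)}^2\leq C_{L,d,\rho}\,K.$$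
   Context: Let $L\geq3$ and $\mathcal A=A_1\times\cdots\times A_d$, so $\#\mathcal A=L$. For a word $\omega=(\alpha_1,\dots,\alpha_n)\in\mathcal A^n$ put $z_\omega=\sum_{k=1}^nL^{-k}\alpha_k$ and $Q_\omega=z_\omega+[0,L^{-n}]^d$. For $\theta\in\mathbb S^{d-1}$ let $\pi_\theta(x)=x\cdot\theta$ and $I_{\omega}=\pi_\theta(Q_\omega)$, a closed interval. The counting function at depth $n$ is $f_{n,\theta}(x)=\sum_{\omega\in\mathcal A^n}\mathbf 1_{I_\omega}(x)$, $x\in\mathbb R$. *)

(* Defs.v *)
From HB Require Import structures.
From mathcomp Require Import all_boot all_order all_algebra.
From mathcomp Require Import all_classical all_reals all_analysis.

Set Implicit Arguments.
Unset Strict Implicit.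
Unset Printing Implicit Defensive.

Import Order.TTheory GRing.Theory Num.Theory.
Import numFieldNormedType.Exports.

Local Open Scope classical_set_scope.
Local Open Scope ring_scope.

Section Hausdorff.
Context {R : realType}.

(* 0 is adjoined so that the empty set has diameter 0 rather than -oo. *)
Definition diam (E : set R) : \bar R :=
  ereal_sup (0%E |` [set `|p.1 - p.2|%:E | p in E `*` E]).

Definition hausdorff1_pre (delta : R) (E : set R) : \bar R :=
  ereal_inf [set (\sum_(0 <= k <oo) diam (F k))%E | F in
    [set F : nat -> set R |
      (forall k, (diam (F k) <= delta%:E)%E) /\ E `<=` \bigcup_k F k]].

(* One-dimensional Hausdorff measure on the line, normalised without any
   constant. *)
Definition hausdorff1 (E : set R) : \bar R :=
  ereal_sup [set hausdorff1_pre delta E | delta in [set delta : R | 0 < delta]].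

End Hausdorff.

Section Projection.
Context {R : realType} {d : nat}.

Definition dot (x y : 'rV[R]_d) : R := \sum_(i < d) x 0 i * y 0 i.

(* Euclidean sphere: the library norm on 'rV[R]_d is the sup norm, hence the
   explicit inner product. *)
Definition sphere : set 'rV[R]_d := [set theta | dot theta theta = 1].

Definition line_proj (theta x : 'rV[R]_d) : R := dot x theta.

End Projection.

Section Counting.
Context {R : realType} {d L : nat}.

Definition digit : finType := {ffun 'I_d -> 'I_L}.

Definition digits (A : 'I_d -> {set 'I_L}) : {set digit} :=
  [set a : digit | [forall i, a i \in A i]].

Definition words (A : 'I_d -> {set 'I_L}) (n : nat) :
    {set {ffun 'I_n -> digit}} :=
  [set w : {ffun 'I_n -> digit} | [forall k, w k \in digits A]].

Definition digit_vec (a : digit) : 'rV[R]_d := \row_(i < d) (a i)%:R.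

(* Letters are indexed from 0 here, which accounts for the exponent k.+1. *)
Definition corner n (w : {ffun 'I_n -> digit}) : 'rV[R]_d :=
  \sum_(k < n) (L%:R ^- k.+1) *: digit_vec (w k).

Definition cube n (w : {ffun 'I_n -> digit}) : set 'rV[R]_d :=
  [set corner w + y | y in
    [set y : 'rV[R]_d | forall i, 0 <= y 0 i <= L%:R ^- n]].

Definition shadow (theta : 'rV[R]_d) n (w : {ffun 'I_n -> digit}) : set R :=
  line_proj theta @` cube w.

Definition counting_fun (A : 'I_d -> {set 'I_L}) (theta : 'rV[R]_d) (n : nat)
    (x : R) : R :=
  \sum_(w in words A n) \1_(shadow theta w) x.

(* The counting_fun functions are nonnegative, so the base value 0 is harmless
   when N >= 1. *)
Definition counting_max (A : 'I_d -> {set 'I_L}) (theta : 'rV[R]_d) (N : nat)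
    (x : R) : R :=
  \big[Num.max/0]_(1 <= n < N.+1) counting_fun A theta n x.

End Counting.

Definition L2norm {R : realType} (f : R -> R) : \bar R :=
  'N[@lebesgue_measure R]_2%:E[EFin \o f].

(* Main.v *)
Require Import Defs.
From mathcomp Require Import all_boot all_order all_algebra.
From mathcomp Require Import all_classical all_reals all_analysis.
From mathcomp Require Import measurable_realfun.
From mathcomp Require Import zify ring lra.

Set Implicit Arguments.
Unset Strict Implicit.
Unset Printing Implicit Defensive.

Import Order.TTheory GRing.Theory Num.Theory.
Import numFieldNormedType.Exports.

Local Open Scope classical_set_scope.
Local Open Scope ring_scope.

(** Write Phi for the integral of g ^ 2, where g is the maximal counting function
    (level 0 included), and T for a multiple of K.  Call a word u stopped when at
    least T words of its length have shadows near that of u, while every proper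
    prefix has fewer than T such neighbours; by the tree structure a stopped word
    has at most L T neighbours.  Off the stopped shadows g < T, and the weak-type
    bound |{g >= j}| <= C / j (Vitali and Kraft's inequality) contributes O(T) to
    Phi.  Near a stopped shadow of length h, self-similarity bounds g by the sum
    of at most L T copies of g rescaled to length h, so Cauchy-Schwarz gives a
    contribution O(T^2 h (1 + Phi)).  By Vitali the stopped shadows can be taken
    disjoint, and, as each has g >= K on a fixed proportion of its neighbourhood,
    a second use of Vitali bounds their total length by C |{g >= K}|, which is at
    most C K^(-rho).  Hence Phi <= C K + C K^(2 - rho) (1 + Phi).  Since Phi is
    finite and rho > 2, the last term is absorbed for large K. *)

(** * Covering, packing, scaling and Hausdorff comparison for Lebesgue measure on the line *)

Section LineMeasure.
Context {R : realType}.
Local Notation leb := (@lebesgue_measure R).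

Lemma integral_indicT (A : set R) : measurable A ->
  (\int[leb]_x (\1_A x)%:E = leb A)%E.
Proof. by move=> mA; rewrite integral_indic// setIT. Qed.

Lemma measure_cover (I : eqType) (s : seq I) (A : I -> set R) (E : set R) :
  (forall i, measurable (A i)) -> measurable E ->
  (forall x, E x -> exists2 i, i \in s & A i x) ->
  (leb E <= \sum_(i <- s) leb (A i))%E.
Proof.
move=> mA; elim: s E => [|i s IH] E mE EA.
  rewrite big_nil (_ : E = set0) ?measure0//.
  by rewrite -subset0 => x /EA[].
rewrite big_cons.
have mI : measurable (E `&` A i) by exact: measurableI.
have mD : measurable (E `\` A i) by exact: measurableD.
have -> : E = (E `&` A i) `|` (E `\` A i) by rewrite setDE -setIUr setUv setIT.
apply: le_trans (measureU2 leb mI mD) _; apply: leeD.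
  by apply: le_measure; rewrite ?inE; [exact: mI|exact: mA|exact: subIsetr].
apply: IH => //.
move=> x [/EA[j]]; rewrite inE => /predU1P[->//|]; by exists j.
Qed.

Lemma measure_packing (I : choiceType) (s : seq I) (A : I -> set R) (E : set R) :
  (forall i, measurable (A i)) -> measurable E -> uniq s -> trivIset [set` s] A ->
  (forall i, i \in s -> A i `<=` E) ->
  (\sum_(i <- s) leb (A i) <= leb E)%E.
Proof.
move=> mA mE us tA AE.
rewrite fsbig_seq// -measure_fin_bigcup//; last by move=> i _; exact: mA.
apply: le_measure; rewrite ?inE.
- by apply: fin_bigcup_measurable => // i _; exact: mA.
- exact: mE.
- by move=> x [i /AE H /H].
Qed.

Lemma vitali_balls (I : eqType) (x r : I -> R) (s : seq I) :
  (forall i, 0 < r i) ->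
  exists s', [/\ uniq s', {subset s' <= s},
    trivIset [set` s'] (fun i => ball (x i) (r i)) &
    forall i y, i \in s -> ball (x i) (r i) y ->
      exists2 j, j \in s' & ball (x j) (3 * r j) y].
Proof.
move=> r0.
have isb i : is_ball (ball (x i) (r i)) by exact: is_ball_ball.
have ne i : ball (x i) (r i) !=set0 by exists (x i); exact: ballxx.
have [s' [us' ss' ts' cs']] := vitali_lemma_finite_cover isb ne s.
exists s'; split => // i y si xy.
have [|j js'] := cs' y; first by exists i.
by rewrite /= scale_ballE //; exists j.
Qed.

(** k times the pushforward of Lebesgue measure under the affine map agrees with Lebesgue measure on
    half-open intervals, hence everywhere by uniqueness. *)
Lemma ge0_integral_affine (p k : R) (f : R -> \bar R) : 0 < k ->
  measurable_fun [set: R] f -> (forall x, 0 <= f x)%E ->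
  (\int[leb]_x f ((x - p) * k)%R = k^-1%:E * \int[leb]_x f x)%E.
Proof.
move=> k0 mf f0.
pose phi (x : measurableTypeR R) : measurableTypeR R := (x - p) * k.
have mphi : measurable_fun setT phi.
  by apply: measurable_funM => //; apply: measurable_funB.
have k'0 : 0 <= k^-1 by rewrite invr_ge0 ltW.
rewrite -(@ge0_integral_mscale _ _ _ leb setT measurableT (NngNum k'0) f)//.
rewrite -[LHS]/(\int[leb]_(x in phi @^-1` setT) (f \o phi) x)%E.
rewrite -ge0_integral_pushforward//.
apply: eq_measure_integral => A mA _.
pose m := mscale (NngNum (ltW k0)) (pushforward leb phi).
have E : leb A = m mphi A.
  apply: lebesgue_measure_unique => // _ [[a b] _ <-].
  transitivity (k%:E * leb (phi @^-1` `]a, b]))%E; last by [].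
  have -> : phi @^-1` `]a, b] = `](a / k + p), (b / k + p)]%classic.
    have phiE x : (phi x \in `]a, b]) = (x \in `](a / k + p), (b / k + p)]).
      rewrite !in_itv /= /phi -ltrBrDr ltr_pdivrMr//.
      by rewrite -[x <= _]lerBlDr ler_pdivlMr.
    by apply/seteqP; split => x; rewrite /= phiE.
  rewrite !lebesgue_measure_itv /= !lte_fin ltrD2r ltr_pM2r ?invr_gt0//.
  case: ifP => _; last by rewrite mule0.
  rewrite -!EFinB -EFinM; congr EFin; field; exact: lt0r_neq0.
transitivity (k^-1%:E * leb A)%E; last by [].
rewrite E -[m mphi A]/(k%:E * leb (phi @^-1` A))%E muleA -EFinM.
by rewrite mulVf ?mul1e ?lt0r_neq0.
Qed.

(** A set of diameter r lies in the interval of radius r about any of its points; this crude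
    inclusion costs the factor 2. The covers at scale 1 suffice, since the Hausdorff measure is a
    supremum over scales. *)
Lemma lebesgue_le_hausdorff1 (E E' : set R) : measurable E -> E `<=` E' ->
  (leb E <= 2%:E * hausdorff1 E')%E.
Proof.
move=> mE EE'.
have H : (2^-1%:E * leb E <= hausdorff1_pre 1 E')%E.
  apply: le_ereal_inf_tmp => _ [F [F1 /(subset_trans EE') EF] <-].
  rewrite lee_pdivrMl// -nneseriesZl; last first.
    by move=> i _; apply: ereal_sup_ubound; left.
  have d0 k : (0 <= diam (F k))%E by apply: ereal_sup_ubound; left.
  have dfin k : diam (F k) \is a fin_num.
    by rewrite ge0_fin_numE//; apply: le_lt_trans (F1 k) _; rewrite ltry.
  have ex k : exists x, forall z, F k z -> `|x - z| <= fine (diam (F k)).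
    have [->|/set0P[y Fy]] := eqVneq (F k) set0.
      by exists 0.
    exists y => z Fz; rewrite -lee_fin fineK//.
    by apply: ereal_sup_ubound; right; exists (y, z).
  have [x Fx] := choice ex.
  pose G k := `[x k - fine (diam (F k)), x k + fine (diam (F k))]%classic.
  apply: (@le_trans _ _ (\sum_(0 <= k <oo) leb (G k))%E).
    apply: measure_sigma_subadditive; [by move=> k; exact: measurable_itv|exact: mE|].
    move=> y /EF[k _ /Fx H].
    exists k => //; rewrite /G /= in_itv /=; move: H; rewrite ler_norml; lra.
  apply: lee_nneseries => [//|k _].
  rewrite /G lebesgue_measure_itv /=; case: ifP => _; last by rewrite mule_ge0.
  rewrite -{3}(fineK (dfin k)) -EFinB -EFinM lee_fin; lra.
rewrite -lee_pdivrMl; last by [].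
apply: le_trans H _.
by apply: ereal_sup_ubound; exists 1; [exact: ltr01|].
Qed.

End LineMeasure.

(** * Words over a finite alphabet *)

Section Strings.
Context {D : choiceType} (ds : seq D).

Fixpoint strings n : seq (seq D) :=
  if n is n'.+1 then [seq a :: w | a <- ds, w <- strings n'] else [:: [::]].

Lemma mem_strings n w :
  (w \in strings n) = (size w == n) && all [in ds] w.
Proof.
elim: n w => [|n IH] [|a w] //=.
- by apply/negP => /allpairsP[[? ?] []].
- rewrite eqSS; apply/allpairsP/idP => [[[a' w']/= [a'ds w's [-> ->]]]|].
    by move: w's; rewrite IH => /andP[-> ->]; rewrite a'ds.
  move=> /and3P[sw ads wds]; exists (a, w) => /=; split => //.
  by rewrite IH sw.
Qed.

Lemma size_strings n w : w \in strings n -> size w = n.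
Proof. by rewrite mem_strings => /andP[/eqP]. Qed.

Lemma take_strings n m u : (m <= n)%N -> u \in strings n ->
  take m u \in strings m /\ drop m u \in strings (n - m).
Proof.
rewrite !mem_strings => mn /andP[/eqP su].
rewrite -{1}(cat_take_drop m u) all_cat => /andP[-> ->].
by rewrite size_takel ?su// size_drop su !eqxx.
Qed.

Lemma strings_uniq n : uniq ds -> uniq (strings n).
Proof.
move=> uds; elim: n => //= n IH; apply: allpairs_uniq => //.
by move=> [a w] [a' w'] /= _ _ [-> ->].
Qed.

Lemma sum_strings_cat n m (F : seq D -> nat) :
  (\sum_(w <- strings (n + m)) F w =
   \sum_(u <- strings n) \sum_(v <- strings m) F (u ++ v))%N.
Proof.
elim: n F => [|n IH] F; first by rewrite big_seq1.
rewrite addSn /= !big_allpairs_dep/=; apply: eq_bigr => a _.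
exact: (IH (fun w => F (a :: w))).
Qed.

Lemma sum_strings1 n : (\sum_(u <- strings n) 1 = size ds ^ n)%N.
Proof.
elim: n => [|n IH]; first by rewrite big_seq1.
rewrite /= big_allpairs_dep /= expnS.
under eq_bigr do rewrite IH.
by rewrite big_const_seq count_predT iter_addn_0 mulnC.
Qed.

End Strings.

(** * Inequalities for finite sums and counts *)

(** Cauchy-Schwarz against the constant 1, by induction; the cross terms are handled by 2ab <= a^2 +
    b^2. *)
Lemma sqr_sum_seq (I : Type) (s : seq I) (F : I -> nat) :
  ((\sum_(i <- s) F i) ^ 2 <= size s * \sum_(i <- s) F i ^ 2)%N.
Proof.
elim: s => [|i s IH]; first by rewrite !big_nil.
rewrite !big_cons /=.
set A := (\sum_(j <- s) F j)%N in IH *; set B := (\sum_(j <- s) _)%N in IH *.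
have H : (2 * (F i * A) <= size s * F i ^ 2 + B)%N.
  rewrite /A /B; elim: s {IH A B} => [|j s IH]; first by rewrite !big_nil muln0.
  rewrite !big_cons /= mulnDr mulSn.
  have [+ _] := nat_Cauchy (F i) (F j); lia.
rewrite sqrnD mulSn mulnDr; lia.
Qed.

Lemma sum_count (T : Type) (s : seq T) (p : pred T) : (\sum_(i <- s) p i = count p s)%N.
Proof. by rewrite -sum1_count [RHS]big_mkcond; apply: eq_bigr => i _; case: (p i). Qed.

Lemma count_le1 (I : eqType) (s : seq I) (P : pred I) : uniq s ->
  (forall u v, u \in s -> v \in s -> P u -> P v -> u = v) -> (count P s <= 1)%N.
Proof.
move=> /(filter_uniq P) us H; rewrite -size_filter.
move: us; case E : (seq.filter P s) => [|u [|v t]]//=.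
have : u \in seq.filter P s by rewrite E inE eqxx.
have : v \in seq.filter P s by rewrite E !inE eqxx orbT.
rewrite !mem_filter => /andP[Pv vs] /andP[Pu su].
by rewrite inE (H _ _ su vs Pu Pv) eqxx.
Qed.

(** The square of g is the sum of the first g odd numbers. This is the layer-cake formula that
    reduces the integral of g^2 over {g <= T} to measures of level sets. *)
Lemma sqr_layers (T g : nat) : (g < T.+1)%N ->
  (g ^ 2 = \sum_(j < T) (2 * j + 1) * (j < g))%N.
Proof.
move=> gT; transitivity (\sum_(j < g) (2 * j + 1))%N.
  elim: g {gT} => [|g IH]; first by rewrite big_ord0.
  rewrite big_ord_recr /= -IH; lia.
rewrite (big_ord_widen T (fun j => 2 * j + 1)%N) // big_mkcond /=.
by apply: eq_bigr => j _; case: ltnP => _; rewrite ?muln1 ?muln0.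
Qed.

(** * Counting shadows of words *)

Section Intervals.
Context {R : realType} {D : choiceType} (ds : seq D) (L : nat) (b : D -> R) (c e : R).
Context (sizeds : size ds = L) (L_gt1 : (1 < L)%N) (ce : c < e).
(** The bound says exactly that each contraction x |-> (b a + x) / L maps [c, e] into itself, which
    makes shadows nested along prefixes. *)
Context (bce : forall a, a \in ds -> (L%:R - 1) * c <= b a <= (L%:R - 1) * e).

Local Notation W := (strings ds).

Definition rad n : R := L%:R^-1 ^+ n.

(* A word u stands for the similarity x |-> pos u + L^-|u| x, whose inverse is
   [zoom u]; with [c, e] the projection of the unit cube, the image of [c, e] is
   the shadow of u. *)
Fixpoint pos (u : seq D) : R := if u is a :: v then (b a + pos v) / L%:R else 0.

Definition in_shadow (u : seq D) (x : R) : bool :=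
  pos u + c * rad (size u) <= x <= pos u + e * rad (size u).

Definition zoom (u : seq D) (x : R) : R := (x - pos u) * L%:R ^+ size u.

Definition width (u : seq D) : R := (e - c) * rad (size u).
Definition mid (u : seq D) : R := pos u + (c + e) / 2 * rad (size u).

Definition cnt n (x : R) : nat := (\sum_(u <- W n) in_shadow u x)%N.

(* Unlike [counting_max], this includes level 0: a zoom may bring any level
   n <= N down to 0. *)
Definition cmax N (x : R) : nat := (\max_(n < N.+1) cnt n x)%N.

Let Lneq0 : L%:R != 0 :> R. Proof. by rewrite pnatr_eq0; lia. Qed.
Let Lgt1 : 1 < L%:R :> R. Proof. by rewrite ltr1n. Qed.
Let Lgt0 : 0 < L%:R :> R. Proof. exact: lt_trans Lgt1. Qed.

(** * Self-similarity and nesting of shadows *)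

Lemma rad_gt0 n : 0 < rad n.
Proof. by rewrite exprn_gt0// invr_gt0 Lgt0. Qed.
Lemma radD n m : rad (n + m) = rad n * rad m. Proof. exact: exprD. Qed.
Lemma rad_le1 n : rad n <= 1.
Proof. by rewrite exprn_ile1// ?invr_ge0 ?invf_le1 ?ltW. Qed.
Lemma radK n : rad n * L%:R ^+ n = 1.
Proof. by rewrite /rad -exprMn mulVf// expr1n. Qed.
Lemma width_gt0 u : 0 < width u.
Proof. by rewrite mulr_gt0 ?rad_gt0// subr_gt0. Qed.

Lemma pos_cat u v : pos (u ++ v) = pos u + rad (size u) * pos v.
Proof.
elim: u => [|a u IH] /=; first by rewrite /rad expr0; ring.
by rewrite IH /rad exprS; field.
Qed.

Lemma in_shadow_cat u v x : in_shadow (u ++ v) x = in_shadow v (zoom u x).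
Proof.
rewrite /in_shadow pos_cat size_cat radD /zoom.
have r0 := rad_gt0 (size u); have rK := radK (size u).
have -> : x = pos u + rad (size u) * ((x - pos u) * L%:R ^+ size u).
  by rewrite mulrCA rK; ring.
set y := (_ - pos u) * _; rewrite /zoom.
have -> : (pos u + rad (size u) * y - pos u) * L%:R ^+ size u = y.
  by rewrite addrC addKr mulrAC rK mul1r.
rewrite -!addrA !lerD2l !(mulrCA _ (rad (size u))) -!mulrDr.
by rewrite !ler_pM2l.
Qed.

(** Removing the first letter leaves a single contraction, which preserves [c, e] by [bce]. *)
Lemma in_shadow_root n u x : u \in W n -> in_shadow u x -> c <= x <= e.
Proof.
elim: n u x => [|n IH] u x.
  by rewrite inE => /eqP->; rewrite /in_shadow /= /rad expr0; lra.
move=> /allpairsP[[a v]/= [ads vW ->]].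
rewrite -cat1s in_shadow_cat => /(IH _ _ vW).
rewrite /zoom /= addr0 expr1 mulrBl divfK//.
by have := bce ads; have := Lgt1; have := ce; nra.
Qed.

Lemma in_shadow_prefix n u v x : v \in W n -> in_shadow (u ++ v) x -> in_shadow u x.
Proof.
move=> vW; rewrite in_shadow_cat => /(in_shadow_root vW).
by rewrite -(cats0 u) in_shadow_cat cats0 /in_shadow /= /rad expr0; lra.
Qed.

(** The self-similarity used in [cmax_stopped]: past level n, counting splits into rescaled copies
    of itself, one for each word of length n. *)
Lemma cntD n m x : cnt (n + m) x = (\sum_(u <- W n) cnt m (zoom u x))%N.
Proof.
rewrite /cnt sum_strings_cat; apply: eq_bigr => u _.
by apply: eq_bigr => v _; rewrite in_shadow_cat.
Qed.

Lemma cnt_eq0 n x : ~~ (c <= x <= e) -> cnt n x = 0%N.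
Proof.
move=> xce; rewrite /cnt big_seq big1// => u uW.
by case: (boolP (in_shadow u x)) => // /(in_shadow_root uW); rewrite (negbTE xce).
Qed.

Lemma cnt_cmax N n x : (n <= N)%N -> (cnt n x <= cmax N x)%N.
Proof.
rewrite -ltnS => nN.
exact: (bigop.leq_bigmax (F := fun n : 'I_N.+1 => cnt n x) (Ordinal nN)).
Qed.

Lemma cmax_cnt N x : exists2 n, (n <= N)%N & cmax N x = cnt n x.
Proof.
rewrite /cmax; have [|i ->] := bigop.eq_bigmax (fun n : 'I_N.+1 => cnt n x).
  by rewrite card_ord.
by exists i => //; rewrite -ltnS.
Qed.

(** * Midpoints and neighbouring words *)

Lemma in_shadowP u x : in_shadow u x = (`|x - mid u| <= width u / 2).
Proof. by rewrite /in_shadow /mid /width ler_norml; apply/idP/idP; lra. Qed.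

(** Nesting of shadows in centre-radius form, read off from the two endpoints of the inner
    interval. *)
Lemma mid_cat n u v : v \in W n ->
  `|mid (u ++ v) - mid u| + width (u ++ v) / 2 <= width u / 2.
Proof.
move=> vW.
have h0 := width_gt0 (u ++ v).
have H1 : in_shadow u (mid (u ++ v) - width (u ++ v) / 2).
  apply: (@in_shadow_prefix n _ v) => //; rewrite in_shadowP ler_norml; lra.
have H2 : in_shadow u (mid (u ++ v) + width (u ++ v) / 2).
  apply: (@in_shadow_prefix n _ v) => //; rewrite in_shadowP ler_norml; lra.
move: H1 H2; rewrite !in_shadowP !ler_norml => /andP[? ?] /andP[? ?].
by rewrite -lerBrDr ler_norml; lra.
Qed.

(* The factor 4 makes v near u as soon as its shadow meets the ball of radius
   3 * width u, where 3 is the enlargement factor in Vitali's lemma. *)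
Definition near u v := `|mid v - mid u| <= 4 * width u.

Definition near_count u : nat := count (near u) (W (size u)).

(** Dropping the suffixes moves each midpoint by at most (width u - width (u ++ u')) / 2, so the
    distance becomes at most width u + 3 width (u ++ u') <= 4 width u. *)
Lemma near_prefix n m u v u' v' : u \in W n -> v \in W n -> u' \in W m -> v' \in W m ->
  near (u ++ u') (v ++ v') -> near u v.
Proof.
move=> uW vW u'W v'W; rewrite /near.
have := mid_cat u u'W; have := mid_cat v v'W.
have -> : width v = width u by rewrite /width (size_strings uW) (size_strings vW).
have -> : width (v ++ v') = width (u ++ u').
  rewrite /width !size_cat (size_strings uW) (size_strings vW).
  by rewrite (size_strings u'W) (size_strings v'W).
have : width (u ++ u') <= width u.
  rewrite /width size_cat radD mulrA ler_piMr ?rad_le1//.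
  exact: ltW (width_gt0 u).
rewrite -!lerBrDr !ler_norml => ? /andP[? ?] /andP[? ?] /andP[? ?].
by apply/andP; lra.
Qed.

Lemma width_size u v : size v = size u -> width v = width u.
Proof. by rewrite /width => ->. Qed.

(** By [near_prefix], each neighbour of the longer word extends a neighbour of u by one of L
    letters. *)
Lemma near_count_rcons n u a : u \in W n -> a \in ds ->
  (near_count (u ++ [:: a]) <= L * near_count u)%N.
Proof.
move=> uW ads; rewrite /near_count -!sum_count size_cat sum_strings_cat (size_strings uW).
rewrite big_distrr/= big_seq [leqRHS]big_seq; apply: leq_sum => v vW.
have aW : [:: a] \in W 1 by rewrite mem_strings /= ads.
apply: (@leq_trans (\sum_(w <- W 1) near u v)).
  rewrite big_seq [leqRHS]big_seq; apply: leq_sum => w wW.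
  by case: (boolP (near _ _)) => // /(near_prefix uW vW aW wW) ->.
rewrite big_const_seq count_predT iter_addn_0 mulnC leq_mul2r.
have : size (W 1) = L by rewrite -sum1_size sum_strings1 expn1.
by move=> ->; rewrite leqnn orbT.
Qed.

Lemma near_in_shadow u v x : size v = size u -> in_shadow v x ->
  `|x - mid u| < 3 * width u -> near u v.
Proof.
move=> /width_size vu; rewrite in_shadowP /near vu => H1 H2; have := width_gt0 u.
move: H1 H2; rewrite !ler_norml ltr_norml; lra.
Qed.

Lemma near_self u : near u u.
Proof. by rewrite /near subrr normr0 mulr_ge0// ltW// width_gt0. Qed.

Lemma ball_prefix n u v x : v \in W n -> `|x - mid (u ++ v)| < 3 * width (u ++ v) ->
  `|x - mid u| < 3 * width u.
Proof.
move=> /(mid_cat u); have := width_gt0 (u ++ v).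
rewrite -lerBrDr ler_norml !ltr_norml; lra.
Qed.

Lemma cnt_near_count u x : `|x - mid u| < 3 * width u ->
  (cnt (size u) x <= near_count u)%N.
Proof.
move=> ux; rewrite /near_count -sum_count /cnt big_seq [leqRHS]big_seq.
apply: leq_sum => v /size_strings vu.
by case: (boolP (in_shadow v x)) => // vx; rewrite (near_in_shadow vu vx ux).
Qed.

(** * Stopped words and heavy intervals *)

Definition tree N := flatten [seq W n | n <- iota 0 N.+1].

Lemma mem_tree N u : (u \in tree N) = (size u <= N)%N && all [in ds] u.
Proof.
apply/flatten_mapP/andP => [[n]|[uN uds]].
  by rewrite mem_iota mem_strings => ? /andP[/eqP -> ->]; split => //; lia.
by exists (size u); rewrite ?mem_strings ?eqxx// mem_iota; lia.
Qed.

Definition stopped T u := (T <= near_count u)%N &&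
  all (fun m => near_count (take m u) < T)%N (iota 0 (size u)).

(** Without its last letter the word has fewer than T neighbours by minimality, and one letter
    multiplies the count by at most L. *)
Lemma stopped_near_count T u : (1 < T)%N -> all [in ds] u -> stopped T u ->
  (near_count u <= L * T)%N.
Proof.
move=> T1; case/lastP: u => [|u a] uds /andP[Tu /allP/= uT].
  (* The empty word has only itself as neighbour, so T > 1 prevents it from being stopped. *)
  by move: Tu; rewrite /near_count/= near_self; lia.
rewrite -cats1; have := uT (size u).
rewrite mem_iota size_rcons /= add0n ltnS leqnn -cats1 take_size_cat// => /(_ isT) uT'.
move: uds; rewrite -cats1 all_cat /= andbT => /andP[uds ads].
apply: leq_trans (@near_count_rcons (size u) _ _ _ ads) _.
  by rewrite mem_strings eqxx.
by rewrite leq_mul2l (ltnW uT') orbT.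
Qed.

Lemma in_shadow_ball u x : in_shadow u x -> `|x - mid u| < width u.
Proof. by rewrite in_shadowP => /le_lt_trans -> //; have := width_gt0 u; lra. Qed.

(** Take a word w through x at a level attaining the maximum. All words counted at x are neighbours
    of w, so w has at least T of them, and its shortest prefix with this property is stopped. *)
Lemma stopped_exists N T x : (0 < T)%N -> (T <= cmax N x)%N ->
  exists u, [/\ u \in tree N, stopped T u & in_shadow u x].
Proof.
move=> T0; have [n nN ->] := cmax_cnt N x => Tx.
have [w wW wx] : exists2 w, w \in W n & in_shadow w x.
  apply/hasP; rewrite has_count -sum_count; exact: leq_trans Tx.
have sw := size_strings wW.
have : exists m, (T <= near_count (take m w))%N.
  exists n; rewrite -sw take_size; apply: leq_trans Tx _.
  rewrite -sw; apply: cnt_near_count; apply: lt_le_trans (in_shadow_ball wx) _.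
  by have := width_gt0 w; lra.
move=> ex; case: (ex_minnP ex) => m Tm mmin.
(* [take] is total, so m could exceed the length of w; then n would already qualify, against
   minimality. *)
have mn : (m <= n)%N.
  rewrite leqNgt; apply/negP => nm.
  have : (T <= near_count (take n w))%N.
    by move: Tm; rewrite !take_oversize ?sw// ltnW.
  by move=> /mmin; rewrite leqNgt nm.
have [mW dW] := take_strings mn wW.
exists (take m w); split.
- by move: mW; rewrite mem_tree mem_strings => /andP[/eqP -> ->]; rewrite (leq_trans mn).
- rewrite /stopped Tm /=; apply/allP => k; rewrite mem_iota (size_strings mW) /= => km.
  rewrite take_takel ?(ltnW km)// ltnNge; apply/negP => /mmin; lia.
- by apply: (in_shadow_prefix dW); rewrite cat_take_drop.
Qed.

(** If the maximum is attained at a level below [size u], the prefix of u at that level has fewer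
    than T neighbours, whence T^2. Otherwise only words near u contribute at x, and Cauchy-Schwarz
    applies to their rescaled counts. *)
Lemma cmax_stopped N T u x : all [in ds] u -> stopped T u ->
  `|x - mid u| < 3 * width u ->
  (cmax N x ^ 2 <= T ^ 2 +
    near_count u * \sum_(v <- W (size u) | near u v) cmax N (zoom v x) ^ 2)%N.
Proof.
move=> uds /andP[Tu /allP/= uT] ux.
have uW : u \in W (size u) by rewrite mem_strings eqxx.
have [n nN ->] := cmax_cnt N x.
have [nu|un] := ltnP n (size u).
  apply: leq_trans (leq_addr _ _); rewrite leq_exp2r// ltnW//.
  have [nW dW] := take_strings (ltnW nu) uW.
  apply: leq_ltn_trans (uT n _); last by rewrite mem_iota.
  rewrite -{1}(size_strings nW); apply: cnt_near_count.
  by apply: (ball_prefix dW); rewrite cat_take_drop.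
apply: leq_trans (leq_addl _ _).
rewrite -(subnKC un) cntD.
have -> : near_count u = size [seq v <- W (size u) | near u v] by rewrite size_filter.
rewrite -[X in (_ <= _ * X)%N]big_filter; apply: leq_trans (sqr_sum_seq _ _).
rewrite leq_exp2r// big_filter [leqRHS]big_mkcond/= big_seq [leqRHS]big_seq.
apply: leq_sum => v /size_strings vu; case: ifPn => [_|unv].
  by apply: cnt_cmax; lia.
rewrite leqn0 /cnt big_seq big1// => w wW; rewrite -in_shadow_cat.
case: (boolP (in_shadow _ _)) => // /(in_shadow_prefix wW) vx.
by rewrite (near_in_shadow vu vx ux) in unv.
Qed.

(* Pigeonhole: the shadow of every near word contains one of 17 intervals of
   length width u / 2. *)
Lemma near_count_heavy k u : (17 * k <= near_count u)%N ->
  exists y, forall x, `|x - y| <= width u / 4 ->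
    (k <= cnt (size u) x)%N /\ `|x - mid u| < 5 * width u.
Proof.
set h := width u; have h0 : 0 < h := width_gt0 u.
(* Midpoints of near words fill at most [mid u - 4h, mid u + 4h]; the y i are the centres of
   consecutive cells of length h/2 starting at the left end. Sixteen cells cover it, and a
   seventeenth catches the right endpoint when t = 16. *)
pose y (i : nat) := mid u - h / 2 - 4 * h + (i%:R + 1) * (h / 2) + h / 4.
pose P i v := `|y i - mid v| <= h / 4.
have cover v : near u v -> exists2 i : 'I_17, true & P i v.
  rewrite /near -/h ler_norml => uv.
  pose t := (mid v - mid u + 4 * h) / (h / 2).
  have t0 : 0 <= t by rewrite divr_ge0//; lra.
  have t16 : t <= 16 by rewrite ler_pdivrMr; lra.
  have tE : mid v = mid u - 4 * h + t * (h / 2) by rewrite divfK; lra.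
  have /andP[i1 i2] := truncn_itv t0; set i := Num.truncn t in i1 i2.
  have i17 : (i < 17)%N.
    by rewrite -(ltr_nat R); apply: le_lt_trans i1 _; apply: le_lt_trans t16 _; rewrite ltr_nat.
  exists (Ordinal i17) => //; rewrite /P /y /= tE ler_norml.
  move: i2; rewrite -natr1 => i2; nra.
move=> knb.
have [i ki] : exists i : 'I_17, (k <= count (P i) (W (size u)))%N.
  apply/existsP; apply: contraPT knb; rewrite negb_exists => /forallP ki.
  apply/negP; rewrite -ltnNge.
  have : (near_count u <= \sum_(i < 17) count (P i) (W (size u)))%N.
    under eq_bigr do rewrite -sum_count.
    rewrite exchange_big/= /near_count -sum_count; apply: leq_sum => v _.
    case: (boolP (near u v)) => // /cover[i _ Piv].
    by rewrite (bigD1 i)//= Piv.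
  move=> /leq_ltn_trans; apply.
  case: k ki => [/(_ ord0)//|k ki].
  have : (\sum_(i < 17) count (P i) (W (size u)) <= \sum_(i < 17) k)%N.
    by apply: leq_sum => i _; have := ki i; rewrite -ltnNge.
  rewrite sum_nat_const card_ord; lia.
exists (y i) => x xy; split.
  apply: leq_trans ki _; rewrite -sum_count /cnt big_seq [leqRHS]big_seq.
  apply: leq_sum => v /size_strings/width_size vu.
  case: (boolP (P i v)) => // Piv; suff -> : in_shadow v x by [].
  by rewrite in_shadowP vu -/h; move: Piv xy; rewrite /P !ler_norml; lra.
have : (i%:R <= 16 :> R) by rewrite ler_nat -ltnS.
have : (0 <= i%:R :> R) by [].
move: xy; rewrite /y ler_norml ltr_norml; nra.
Qed.

(** * Measurability, the weak-type bound and the packing of stopped shadows *)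

Local Notation leb := (@lebesgue_measure R).

Lemma measurable_cnt n : measurable_fun [set: R] (fun x => (cnt n x)%:R : R).
Proof.
have -> : (fun x => (cnt n x)%:R : R) = (fun x => \sum_(u <- W n)
    \1_(`[pos u + c * rad (size u), pos u + e * rad (size u)]%classic) x).
  apply/funext => x; rewrite /cnt natr_sum; apply: eq_bigr => u _.
  by rewrite indicE; congr (nat_of_bool _)%:R; rewrite mem_setE in_itv.
apply: measurable_sum => u; apply: measurable_indic; exact: measurable_itv.
Qed.

Lemma measurable_cmax N : measurable_fun [set: R] (fun x => (cmax N x)%:R : R).
Proof.
elim: N => [|N IH].
  under eq_fun do rewrite /cmax big_ord_recr big_ord0 /= max0n.
  exact: measurable_cnt.
have -> : (fun x => (cmax N.+1 x)%:R : R) =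
    (fun x => (cmax N x)%:R) \max (fun x => (cnt N.+1 x)%:R).
  apply/funext => x; rewrite /cmax big_ord_recr /=.
  rewrite /Order.max ltr_nat /maxn; by case: ifP.
by apply: measurable_maxr => //; exact: measurable_cnt.
Qed.

Definition level N j : set R := [set x | (j <= cmax N x)%N].

Lemma measurable_level N j : measurable (level N j).
Proof.
have -> : level N j = [set: R] `&`
    (fun x => (cmax N x)%:R : R) @^-1` `[j%:R, +oo[%classic.
  by apply/seteqP; split => x; rewrite /level /= in_itv /= andbT ler_nat //; case.
exact: measurable_cmax.
Qed.

(* Count the words of length N whose midpoint lies in one of the disjoint balls. *)
Lemma kraft N j (s : seq (seq D)) : uniq s -> {subset s <= tree N} ->
  trivIset [set` s] (fun u => ball (mid u) (2 * width u)) ->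
  (forall u, u \in s ->
     (j <= count (fun v => `|mid v - mid u| <= width u)%R (W (size u)))%N) ->
  j%:R * \sum_(u <- s) rad (size u) <= 1.
Proof.
move=> us sN ts sj.
have H : (\sum_(u <- s) j * L ^ (N - size u) <= L ^ N)%N.
  pose P u w := (`|mid u - mid w| < 2 * width u)%R.
  apply: (@leq_trans (\sum_(u <- s) \sum_(w <- W N) P u w)).
    rewrite big_seq [leqRHS]big_seq; apply: leq_sum => u su.
    have /andP[uN _] : (size u <= N)%N && all [in ds] u by rewrite -mem_tree sN.
    rewrite -{2}(subnKC uN) sum_strings_cat.
    (* Each v counted in [sj] has L^(N - size u) extensions to length N, and their midpoints stay
       within 3/2 [width u] of [mid u]. *)
    apply: leq_trans (leq_mul (sj u su) (leqnn _)) _.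
    rewrite -sum_count big_distrl/= big_seq [leqRHS]big_seq; apply: leq_sum => v vW.
    case: (boolP (`|mid v - mid u| <= width u)) => [vu|_]; last by rewrite mul0n.
    rewrite mul1n -sizeds -(sum_strings1 ds) big_seq [leqRHS]big_seq.
    apply: leq_sum => w wW; suff -> : P u (v ++ w) by [].
    have := mid_cat v wW; have := width_gt0 (v ++ w); have := width_gt0 u.
    rewrite (width_size (size_strings vW)) /P -lerBrDr.
    by move: vu; rewrite !ler_norml ltr_norml; lra.
  rewrite exchange_big -sizeds -(sum_strings1 ds); apply: leq_sum => w _.
  rewrite sum_count; apply: count_le1 => // u v su sv Pu Pv.
  by apply: ts => //; exists (mid w).
have L0 : 0 < L%:R ^+ N :> R by rewrite exprn_gt0.
rewrite -(ler_pM2r L0) mul1r mulr_sumr mulr_suml -natrX.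
apply: le_trans (_ : _ <= (\sum_(u <- s) j * L ^ (N - size u))%N%:R) _;
  last by rewrite ler_nat.
rewrite natr_sum big_seq [leRHS]big_seq; apply: ler_sum => u su.
have /andP[uN _] : (size u <= N)%N && all [in ds] u by rewrite -mem_tree sN.
rewrite -{1}(subnKC uN) !natrM !natrX exprD.
by rewrite mulrA -(mulrA _ (rad _)) radK mulr1.
Qed.

(** Two shadows of equal length through x have midpoints at most one width apart, so a point of the
    level set lies in the ball of a word to which [kraft] applies. Vitali triples balls of radius 2
    [width u] into intervals of length 12 [width u]. *)
Lemma level_weak N j : (j%:R%:E * leb (level N j) <= (12 * (e - c))%:E)%E.
Proof.
case: j => [|j]; first by rewrite mul0e lee_fin; have := ce; lra.
pose sub u v := `|mid v - mid u| <= width u.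
pose s := [seq u <- tree N | (j < count (sub u) (W (size u)))%N].
have r0 u : 0 < 2 * width u by rewrite mulr_gt0// width_gt0.
have [s' [us' ss' ts' cs']] := vitali_balls mid s r0.
have K : j.+1%:R * \sum_(u <- s') rad (size u) <= 1.
  apply: (@kraft N) => // u /ss'; rewrite mem_filter => /andP[] //.
have C : (leb (level N j.+1) <= \sum_(u <- s') leb (ball (mid u) (3 * (2 * width u))))%E.
  apply: measure_cover; [by move=> i; exact: measurable_ball|exact: measurable_level|].
  move=> x; rewrite /level /=; have [n nN ->] := cmax_cnt N x => jx.
  have [u uW ux] : exists2 u, u \in W n & in_shadow u x.
    by apply/hasP; rewrite has_count -sum_count; exact: leq_trans jx.
  apply: (cs' u); last first.
    by apply: lt_le_trans (_ : width u <= _);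
      [rewrite distrC in_shadow_ball|have := width_gt0 u; lra].
  rewrite mem_filter mem_tree (size_strings uW) nN /=.
  have -> : all [in ds] u by move: uW; rewrite mem_strings => /andP[].
  rewrite andbT; apply: leq_trans jx _; rewrite -sum_count /cnt big_seq [leqRHS]big_seq.
  apply: leq_sum => v vW; case: (boolP (in_shadow v x)) => // vx.
  suff -> : sub u v by [].
  move: ux vx; rewrite !in_shadowP /sub (width_size (_ : size v = size u)).
    by rewrite !ler_norml; lra.
  by rewrite (size_strings uW) (size_strings vW).
have jj : (0 <= j.+1%:R%:E :> \bar R)%E by rewrite lee_fin.
apply: le_trans (lee_wpmul2l jj C) _.
have -> : (\sum_(u <- s') leb (ball (mid u) (3 * (2 * width u))) =
   (12 * (e - c) * \sum_(u <- s') rad (size u))%:E)%E.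
  rewrite mulr_sumr -sumEFin; apply: eq_bigr => u _.
  rewrite lebesgue_measure_ball; last by rewrite mulr_ge0// ltW.
  by rewrite /width; congr EFin; ring.
rewrite -EFinM lee_fin mulrCA -[leRHS]mulr1 ler_wpM2l//.
by have := ce; lra.
Qed.

(** Each ball of radius 5 [width u] contains an interval of length [width u] / 2 where the count is
    at least k. For a disjoint Vitali subfamily these intervals pack into the level set, while the
    tripled balls, of length 30 [width u], contain all the original disjoint balls, of length 2
    [width u]: the constant is 30 / 2 * 2. *)
Lemma heavy_packing N k (s : seq (seq D)) : uniq s -> {subset s <= tree N} ->
  trivIset [set` s] (fun u => ball (mid u) (width u)) ->
  (forall u, u \in s -> (17 * k <= near_count u)%N) ->
  ((\sum_(u <- s) width u)%:E <= 30%:E * leb (level N k))%E.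
Proof.
move=> us sN ts sk.
have r0 u : 0 < 5 * width u by rewrite mulr_gt0// width_gt0.
have [s' [us' ss' ts' cs']] := vitali_balls mid s r0.
have [Y HY] : exists Y : seq D -> R, forall u, (17 * k <= near_count u)%N ->
    forall x, `|x - Y u| <= width u / 4 ->
    (k <= cnt (size u) x)%N /\ `|x - mid u| < 5 * width u.
  have ex u : exists y, (17 * k <= near_count u)%N -> forall x, `|x - y| <= width u / 4 ->
    (k <= cnt (size u) x)%N /\ `|x - mid u| < 5 * width u.
    have [/near_count_heavy[y Hy]|] := boolP (17 * k <= near_count u)%N; last by exists 0.
    by exists y.
  by have [Y HY] := choice ex; exists Y.
have P2 : (\sum_(u <- s') leb `[(Y u - width u / 4)%R, (Y u + width u / 4)%R]%classic <=
    leb (level N k))%E.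
  apply: measure_packing; [|exact: measurable_level|exact: us'| |].
  - by move=> u; exact: measurable_itv.
  - move=> u v su sv [x [xu xv]]; apply: ts' => //; exists x; split.
      have [|_] := HY u (sk u (ss' u su)) x; last by rewrite distrC.
      by move: xu; rewrite /= in_itv /= ler_norml; lra.
    have [|_] := HY v (sk v (ss' v sv)) x; last by rewrite distrC.
    by move: xv; rewrite /= in_itv /= ler_norml; lra.
  - move=> u su x; rewrite /= in_itv /= => xu.
  have [|ku _] := HY u (sk u (ss' u su)) x; first by rewrite ler_norml; lra.
  apply: leq_trans ku _; apply: cnt_cmax.
  by have := sN u (ss' u su); rewrite mem_tree => /andP[].
pose E := \bigcup_(u in [set` s']) ball (mid u) (3 * (5 * width u)).
have mE : measurable E.
  by apply: fin_bigcup_measurable => // i _; exact: measurable_ball.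
have P1 : (\sum_(u <- s) leb (ball (mid u) (width u)) <= leb E)%E.
  apply: measure_packing; [|exact: mE|exact: us|exact: ts|].
  - by move=> u; exact: measurable_ball.
  - move=> u su x ux; have [|v vs vx] := cs' u x su; last by exists v.
    by apply: lt_trans ux _; have := width_gt0 u; lra.
have P3 : (leb E <= \sum_(u <- s') leb (ball (mid u) (3 * (5 * width u))))%E.
  apply: measure_cover; [|exact: mE|].
  - by move=> u; exact: measurable_ball.
  - by move=> x [u us'u ux]; exists u.
have E1 : (\sum_(u <- s) leb (ball (mid u) (width u)) = (2 * \sum_(u <- s) width u)%:E)%E.
  rewrite mulr_sumr -sumEFin; apply: eq_bigr => u _.
  by rewrite lebesgue_measure_ball ?ltW ?width_gt0//; congr EFin; ring.
have E3 : (\sum_(u <- s') leb (ball (mid u) (3 * (5 * width u))) =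
    (30 * \sum_(u <- s') width u)%:E)%E.
  rewrite mulr_sumr -sumEFin; apply: eq_bigr => u _.
  rewrite lebesgue_measure_ball; last by rewrite mulr_ge0// ltW.
  by congr EFin; ring.
have E2 : (\sum_(u <- s') leb `[(Y u - width u / 4)%R, (Y u + width u / 4)%R]%classic =
    (2^-1 * \sum_(u <- s') width u)%:E)%E.
  rewrite mulr_sumr -sumEFin; apply: eq_bigr => u _.
  rewrite lebesgue_measure_itv /= lte_fin; have := width_gt0 u => h0.
  rewrite ifT; last lra.
  by rewrite -EFinB; congr EFin; lra.
have := le_trans P1 P3; rewrite E1 E3 lee_fin => Q.
move: P2; rewrite E2 => P2.
rewrite -lee_pdivrMl; last by [].
apply: le_trans P2; rewrite -EFinM lee_fin; lra.
Qed.

(** * The recursive energy inequality *)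

Definition energy N : \bar R := (\int[leb]_x ((cmax N x ^ 2)%N%:R)%:E)%E.

Let measurable_cmax2 N : measurable_fun [set: R]
  (fun x => ((cmax N x ^ 2)%N%:R : R)%:E).
Proof.
apply/measurable_EFinP; under eq_fun do rewrite natrX.
by apply: measurable_funX; exact: measurable_cmax.
Qed.

(** The maximal count is at most L^N and vanishes off [c, e]. Finiteness is what allows the energy
    to be absorbed later. *)
Lemma energy_fin N : energy N \is a fin_num.
Proof.
have mI : measurable `[c, e]%classic by exact: measurable_itv.
rewrite ge0_fin_numE; last by apply: integral_ge0 => x _; rewrite lee_fin.
apply: (@le_lt_trans _ _ (\int[leb]_x (((L ^ N) ^ 2)%N%:R%:E *
    (\1_(`[c, e]%classic) x)%:E))%E).
  apply: ge0_le_integral; [exact: measurableT| |exact: measurable_cmax2| |].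
  - by move=> x _; rewrite lee_fin.
  - by apply: measurable_funeM; apply/measurable_EFinP; exact: measurable_indic.
  - move=> x _; rewrite -EFinM lee_fin indicE mem_setE in_itv /=.
    have [n nN ->] := cmax_cnt N x.
    case: (boolP (c <= x <= e)) => [_|/cnt_eq0 ->]; last by rewrite exp0n// mulr0.
    rewrite mulr1 ler_nat leq_exp2r//.
    apply: (@leq_trans (L ^ n)); last by rewrite leq_pexp2l// ltnW.
    rewrite -sizeds -(sum_strings1 ds) /cnt; apply: leq_sum => u _.
    by case: in_shadow.
rewrite ge0_integralZl//; last first.
  by apply/measurable_EFinP; exact: measurable_indic.
rewrite integral_indicT// lebesgue_measure_itv /=.
case: ifP => _; last by rewrite mule0 ltry.
by rewrite -EFinB -EFinM ltry.
Qed.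

Lemma integral_zoom N u :
  (\int[leb]_x ((cmax N (zoom u x) ^ 2)%N%:R)%:E = (rad (size u))%:E * energy N)%E.
Proof.
rewrite (ge0_integral_affine (pos u) _ (measurable_cmax2 N));
  last by move=> x; rewrite lee_fin.
  by rewrite /rad exprVn.
by rewrite exprn_gt0.
Qed.

(** The energy bounds itself, with a coefficient that is small once T^2 M is. The choice T = 17 k
    matches the pigeonhole loss in [near_count_heavy]. *)
Lemma energy_le N k T (M : R) : (0 < k)%N -> T = (17 * k)%N ->
  (leb (level N k) <= M%:E)%E ->
  fine (energy N) <= 24 * (e - c) * T%:R
    + 30 * T%:R ^+ 2 * M * (6 + L%:R ^+ 2 / (e - c) * fine (energy N)).
Proof.
move=> k0 TE kM; have T1 : (1 < T)%N by lia.
set F := fine (energy N); have FE : energy N = F%:E by rewrite fineK// energy_fin.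
have F0 : 0 <= F.
  by apply: fine_ge0; apply: integral_ge0 => x _; rewrite lee_fin.
pose s := [seq u <- tree N | stopped T u].
have [s' [us' ss' ts' cs']] := vitali_balls mid s width_gt0.
have s'P u : u \in s' -> [/\ u \in tree N, all [in ds] u & stopped T u].
  move=> /ss'; rewrite mem_filter => /andP[-> uN]; split=> //.
  by move: uN; rewrite mem_tree => /andP[].
pose B u := ball (mid u) (3 * width u).
have mB u : measurable (B u) by exact: measurable_ball.
(* [f1] gives the square of the count where it is at most T; elsewhere x lies in some selected
   [B u], where [f2] and [f3] carry the two terms of [cmax_stopped]. Being nonnegative, [f3] can be
   left unrestricted, so that its integral is given by scaling. *)
pose f1 x := (\sum_(j < T) (2 * j + 1)%N%:R%:E * (\1_(level N j.+1) x)%:E : \bar R)%E.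
pose f2 u x := ((T ^ 2)%N%:R%:E * (\1_(B u) x)%:E : \bar R)%E.
pose f3 u x := ((near_count u)%:R%:E * \sum_(v <- W (size u) | near u v)
  ((cmax N (zoom v x) ^ 2)%N%:R)%:E : \bar R)%E.
pose f x := (f1 x + \sum_(u <- s') (f2 u x + f3 u x))%E.
have f10 x : (0 <= f1 x)%E by apply: sume_ge0 => j _; rewrite -EFinM lee_fin.
have f20 u x : (0 <= f2 u x)%E by rewrite /f2 -EFinM lee_fin.
have f30 u x : (0 <= f3 u x)%E.
  by apply: mule_ge0; [rewrite lee_fin|apply: sume_ge0 => v _; rewrite lee_fin].
have f230 u x : (0 <= f2 u x + f3 u x)%E by rewrite adde_ge0.
have pointwise x : ((cmax N x ^ 2)%N%:R%:E <= f x)%E.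
  have f1E : f1 x = (\sum_(j < T) (2 * j + 1) * (j < cmax N x))%N%:R%:E.
    rewrite /f1 natr_sum -sumEFin; apply: eq_bigr => j _.
    by rewrite -EFinM indicE natrM; congr (_ * (nat_of_bool _)%:R)%:E; rewrite mem_setE.
  have [gT|Tg] := leqP (cmax N x) T.
    rewrite (sqr_layers (gT : _ < T.+1)%N) -f1E leeDl//.
    exact: sume_ge0.
  have [u [uN uT ux]] := stopped_exists (ltnW T1) (ltnW Tg).
  have [||v vs vx] := cs' u x; first by rewrite mem_filter uT.
    by rewrite /ball /= distrC in_shadow_ball.
  have [vN vds vT] := s'P v vs.
  rewrite /f (big_rem v)//= addeCA; apply: le_trans (leeDl _ _); last first.
    by apply: adde_ge0 => //; exact: sume_ge0.
  have := @cmax_stopped N T v x vds vT; rewrite distrC => /(_ vx) H.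
  have vB : \1_(B v) x = 1 :> R by rewrite indicE mem_set.
  rewrite /f2 /f3 vB sumEFin -!EFinM -EFinD lee_fin mulr1.
  by rewrite -natr_sum -natrM -natrD ler_nat.
have mf1 : measurable_fun [set: R] f1.
  apply: emeasurable_sum => j; apply: measurable_funeM; apply/measurable_EFinP.
  by apply: measurable_indic; exact: measurable_level.
have mf2 u : measurable_fun [set: R] (f2 u).
  by apply: measurable_funeM; apply/measurable_EFinP; exact: measurable_indic.
have mG v : measurable_fun [set: R] (fun x => ((cmax N (zoom v x) ^ 2)%N%:R : R)%:E).
  apply: (measurableT_comp (measurable_cmax2 N)); apply: measurable_funM => //.
  exact: measurable_funB.
have mf3 u : measurable_fun [set: R] (f3 u).
  apply: measurable_funeM; under eq_fun do rewrite -big_filter.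
  exact: emeasurable_sum.
have mf23 u : measurable_fun [set: R] (fun x => f2 u x + f3 u x)%E.
  exact: emeasurable_funD.
have int1 : (\int[leb]_x f1 x <= (24 * (e - c) * T%:R)%:E)%E.
  have mj (j : 'I_T) : measurable_fun [set: R]
      (fun x => (2 * j + 1)%N%:R%:E * (\1_(level N j.+1) x)%:E : \bar R)%E.
    apply: measurable_funeM; apply/measurable_EFinP.
    by apply: measurable_indic; exact: measurable_level.
  rewrite (ge0_integral_sum leb measurableT mj); last first.
    by move=> j x _; rewrite -EFinM lee_fin.
  apply: (@le_trans _ _ (\sum_(j < T) (24 * (e - c))%:E)%E); last first.
    by rewrite sumEFin sumr_const card_ord mulr_natr.
  apply: lee_sum => j _.
  have mI : measurable_fun [set: R] (fun x => (\1_(level N j.+1) x : R)%:E).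
    by apply/measurable_EFinP; apply: measurable_indic; exact: measurable_level.
  rewrite (ge0_integralZl leb measurableT mI) ?lee_fin//.
  rewrite integral_indicT; last exact: measurable_level.
  (* As 2j + 1 <= 2(j + 1), each of the T layers costs at most twice 12 (e - c). *)
  have := level_weak N j.+1 => H.
  apply: (@le_trans _ _ (2%:E * (j.+1%:R%:E * leb (level N j.+1)))%E).
    rewrite muleA -EFinM -natrM; apply: lee_wpmul2r => //.
    by rewrite lee_fin ler_nat; lia.
  apply: le_trans (lee_wpmul2l _ H) _ => //.
  by rewrite -EFinM lee_fin; have := ce; lra.
have int2 u : (\int[leb]_x f2 u x = ((T ^ 2)%N%:R * (6 * width u))%:E)%E.
  have mI : measurable_fun [set: R] (fun x => (\1_(B u) x : R)%:E).
    by apply/measurable_EFinP; exact: measurable_indic.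
  rewrite (ge0_integralZl leb measurableT mI) ?lee_fin//.
  rewrite integral_indicT// lebesgue_measure_ball; last first.
    by rewrite mulr_ge0// ltW// width_gt0.
  by rewrite -EFinM; congr EFin; ring.
have int3 u : (\int[leb]_x f3 u x = ((near_count u)%:R ^+ 2 * rad (size u) * F)%:E)%E.
  have mS : measurable_fun [set: R] (fun x => \sum_(v <- W (size u) | near u v)
      ((cmax N (zoom v x) ^ 2)%N%:R : R)%:E)%E.
    by under eq_fun do rewrite -big_filter; exact: emeasurable_sum.
  rewrite (ge0_integralZl leb measurableT mS) ?lee_fin//; last first.
    by move=> x _; apply: sume_ge0 => v _; rewrite lee_fin.
  under eq_integral do rewrite -big_filter.
  rewrite (ge0_integral_sum leb measurableT mG)//.
  rewrite big_filter big_seq_cond.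
  rewrite (eq_bigr (fun=> (rad (size u) * F)%:E)); last first.
    by move=> v /andP[/size_strings vu _]; rewrite integral_zoom FE vu EFinM.
  rewrite -big_seq_cond sumEFin -big_filter big_const_seq count_predT iter_addr_0.
  rewrite size_filter -/(near_count u) -EFinM; congr EFin.
  by rewrite -[_ *+ near_count u]mulr_natl; ring.
have tot : F <= 24 * (e - c) * T%:R +
    \sum_(u <- s') ((T ^ 2)%N%:R * (6 * width u) +
      (near_count u)%:R ^+ 2 * rad (size u) * F).
  rewrite -lee_fin -FE EFinD.
  apply: (@le_trans _ _ (\int[leb]_x f x)%E).
    apply: ge0_le_integral; [exact: measurableT| |exact: measurable_cmax2| |].
    - by move=> x _; rewrite lee_fin.
    - by apply: emeasurable_funD => //; exact: emeasurable_sum.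
    - by move=> x _; exact: pointwise.
  have m2 : measurable_fun [set: R] (fun x => \sum_(u <- s') (f2 u x + f3 u x))%E.
    exact: emeasurable_sum.
  have i20 x : (0 <= \sum_(u <- s') (f2 u x + f3 u x))%E by exact: sume_ge0.
  rewrite (ge0_integralD leb measurableT (fun x _ => f10 x) mf1 (fun x _ => i20 x) m2).
  apply: leeD => //.
  rewrite (ge0_integral_sum leb measurableT mf23)//.
  rewrite -sumEFin; apply: lee_sum => u _.
  rewrite (ge0_integralD leb measurableT (fun x _ => f20 u x) (mf2 u)
    (fun x _ => f30 u x) (mf3 u)).
  by rewrite int2 int3 -EFinD.
have ec : 0 < e - c by rewrite subr_gt0.
(* Vitali made the unenlarged balls disjoint, and stopping gives each word at least T = 17 k
   neighbours. *)
have hM : \sum_(u <- s') width u <= 30 * M.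
  rewrite -lee_fin EFinM; apply: le_trans (_ : _ <= 30%:E * leb (level N k))%E _.
    by apply: heavy_packing => // [u /s'P[]|u /s'P[_ _ /andP[uT _]]]; rewrite -?TE.
  by apply: (lee_wpmul2l _ kM); rewrite lee_fin.
have K0 : 0 <= T%:R ^+ 2 * (6 + L%:R ^+ 2 / (e - c) * F).
  by rewrite mulr_ge0 ?exprn_ge0// addr_ge0// mulr_ge0// divr_ge0 ?exprn_ge0// ltW.
apply: le_trans tot _; rewrite lerD2l.
rewrite (_ : 30 * T%:R ^+ 2 * M * _ =
  30 * M * (T%:R ^+ 2 * (6 + L%:R ^+ 2 / (e - c) * F))); last by ring.
apply: le_trans (_ : _ <= (\sum_(u <- s') width u) * _) (ler_wpM2r K0 hM).
rewrite mulr_suml big_seq [leRHS]big_seq; apply: ler_sum => u /s'P[_ uds uT].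
have nbT : (near_count u)%:R ^+ 2 <= L%:R ^+ 2 * T%:R ^+ 2 :> R.
  by rewrite -!natrX -natrM ler_nat -expnMn leq_exp2r// stopped_near_count.
rewrite mulrDr mulrDr natrX; apply: lerD.
  by rewrite le_eqVlt; apply/orP; left; apply/eqP; ring.
have -> : width u * (T%:R ^+ 2 * (L%:R ^+ 2 / (e - c) * F)) =
    (L%:R ^+ 2 * T%:R ^+ 2) * (rad (size u) * F).
  by rewrite /width; field; rewrite gt_eqF.
by rewrite -mulrA ler_wpM2r// mulr_ge0// ltW// rad_gt0.
Qed.

End Intervals.

(** * Shadows of cubes *)

Section Bridge.
Context {R : realType} {d L : nat}.
Context (A : 'I_d -> {set 'I_L}) (theta : 'rV[R]_d).
Context (cardA : (\prod_(i < d) #|A i|)%N = L) (theta1 : sphere theta).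
Context (L_gt2 : (2 < L)%N).

Local Notation digit := (@digit d L).

Definition dlist : seq digit := enum (digits A).
Definition proj (a : digit) : R := \sum_(i < d) (a i)%:R * theta 0 i.
(** The unit cube projects onto [[pmin], [pmax]]: the extremal vertex has each coordinate 0 or 1
    according to the sign of that of theta. *)
Definition pmin : R := \sum_(i < d) Num.min (theta 0 i) 0.
Definition pmax : R := \sum_(i < d) Num.max (theta 0 i) 0.

Lemma size_dlist : size dlist = L.
Proof.
rewrite -cardE -[RHS]cardA /digits cardsE.
rewrite (eq_card (_ : _ =i family (fun i => mem (A i)))); last first.
  by move=> a; apply/forallP/familyP.
by rewrite card_family foldrE big_map -big_enum.
Qed.

(** Holds coordinate by coordinate, as digits lie between 0 and L - 1; this supplies the invariance
    hypothesis [bce]. *)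
Lemma proj_bound a : (L%:R - 1) * pmin <= proj a <= (L%:R - 1) * pmax.
Proof.
rewrite /proj /pmin /pmax !mulr_sumr; apply/andP; split; apply: ler_sum => i _.
all: have a1 : (a i)%:R <= L%:R - 1 :> R
  by rewrite lerBrDr natr1 ler_nat.
all: have a0 : 0 <= (a i)%:R :> R by [].
all: rewrite /Order.min /Order.max; case: ltP; nra.
Qed.

(** The difference is the l^1 norm of theta. Since every |theta_i| <= 1, it is at least the sum of
    the squares, which is 1, and at most d; this frees the final constants from theta. *)
Lemma pwidth : 1 <= pmax - pmin <= d%:R.
Proof.
have E : \sum_(i < d) theta 0 i ^+ 2 = 1.
  by rewrite -[RHS]theta1; apply: eq_bigr => i _; rewrite expr2.
have t1 i : `|theta 0 i| <= 1.
  have : theta 0 i ^+ 2 <= 1.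
    by rewrite -E (bigD1 i)//= lerDl sumr_ge0// => j _; exact: sqr_ge0.
  by rewrite ler_norml; nra.
have -> : pmax - pmin = \sum_(i < d) `|theta 0 i|.
  rewrite /pmax /pmin -sumrB; apply: eq_bigr => i _.
  rewrite /Order.min /Order.max.
  by case: ltP => t0; [rewrite ltr0_norm//|rewrite ger0_norm//]; lra.
apply/andP; split.
  rewrite -[leLHS]E; apply: ler_sum => i _.
  by rewrite -real_normK ?num_real// expr2 ler_piMl.
apply: le_trans (_ : _ <= \sum_(i < d) 1) _; first by apply: ler_sum.
by rewrite sumr_const card_ord.
Qed.

Lemma pmin_lt_pmax : pmin < pmax.
Proof. by have := pwidth; lra. Qed.

Definition code n (w : {ffun 'I_n -> digit}) : seq digit :=
  [seq w k | k <- enum 'I_n].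

Lemma pos_map (D : choiceType) (b : D -> R) n (f : 'I_n -> D) :
  pos L b [seq f k | k <- enum 'I_n] = \sum_(k < n) L%:R ^- k.+1 * b (f k).
Proof.
elim: n f => [|n IH] f; first by rewrite big_ord0 -[enum _]/(enum 'I_0) enum_ord0.
rewrite enum_ordSl /= -map_comp IH big_ord_recl mulrDl expr1 mulrC; congr (_ + _).
rewrite mulr_suml; apply: eq_bigr => k _ /=.
by rewrite mulrAC -invfM -exprSr.
Qed.

Lemma shadowP n (w : {ffun 'I_n -> digit}) x :
  shadow theta w x <-> in_shadow L proj pmin pmax (code w) x.
Proof.
have projE : line_proj theta (corner w) = pos L proj (code w).
  rewrite /line_proj /dot /corner pos_map.
  under eq_bigr do rewrite summxE mulr_suml.
  rewrite exchange_big /=; apply: eq_bigr => k _.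
  rewrite /proj mulr_sumr; apply: eq_bigr => i _.
  by rewrite !mxE mulrA.
have lineD (y z : 'rV[R]_d) : line_proj theta (y + z) =
    line_proj theta y + line_proj theta z.
  by rewrite /line_proj /dot -big_split; apply: eq_bigr => i _; rewrite mxE mulrDl.
have sz : size (code w) = n by rewrite size_map size_enum_ord.
have r0 := @rad_gt0 R L (ltnW L_gt2) n.
have rE : L%:R ^- n = rad L n :> R by rewrite /rad exprVn.
rewrite /shadow /cube /in_shadow sz; split.
  move=> [_ [y yr <-] <-]; rewrite lineD projE !lerD2l.
  rewrite /line_proj /dot /pmin /pmax !mulr_suml.
  apply/andP; split; apply: ler_sum => i _; have := yr i; rewrite rE.
    by rewrite /Order.min; case: ltP; nra.
  by rewrite /Order.max; case: ltP; nra.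
move=> xI.
pose s := (x - pos L proj (code w) - pmin * rad L n) / ((pmax - pmin) * rad L n).
have w0 : 0 < (pmax - pmin) * rad L n by rewrite mulr_gt0// subr_gt0 pmin_lt_pmax.
have s01 : 0 <= s <= 1 by rewrite divr_ge0 ?ler_pdivrMr//; lra.
have sE : s * ((pmax - pmin) * rad L n) = x - pos L proj (code w) - pmin * rad L n.
  by rewrite divfK// gt_eqF.
(* As s runs from 0 to 1, y follows the diagonal of the cube from the vertex of least projection to
   that of greatest; s is the relative position of x in the shadow. *)
pose y : 'rV[R]_d := \row_i (rad L n * (if 0 <= theta 0 i then s else 1 - s)).
exists (corner w + y).
  exists y => // i; rewrite rE mxE; case: ifP => _; nra.
rewrite lineD projE.
have -> : line_proj theta y = rad L n * (s * pmax + (1 - s) * pmin).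
  rewrite /line_proj /dot /pmax /pmin !mulr_sumr -big_split mulr_sumr.
  apply: eq_bigr => i _; rewrite mxE /Order.min /Order.max /= ltNge.
  by case: leP => _ /=; ring.
by lra.
Qed.

Lemma code_words n : perm_eq [seq code w | w <- enum (words A n)] (strings dlist n).
Proof.
apply: uniq_perm.
- rewrite map_inj_uniq ?enum_uniq// => w w' /eq_in_map E.
  by apply/ffunP => k; apply: E; rewrite mem_enum.
- by apply: strings_uniq; exact: enum_uniq.
move=> u; rewrite mem_strings; apply/mapP/andP.
  move=> [w]; rewrite mem_enum inE => /forallP wA ->.
  rewrite size_map size_enum_ord; split=> //.
  by apply/allP => a /mapP[k _ ->]; rewrite mem_enum.
move=> [su /allP uA]; pose t := Tuple su.
exists [ffun k => tnth t k].
  rewrite mem_enum inE; apply/forallP => k; rewrite ffunE.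
  by have := uA (tnth t k) (mem_tnth k t); rewrite mem_enum.
rewrite /code; under eq_map do rewrite ffunE.
by rewrite map_tnth_enum.
Qed.

Lemma counting_funE n x :
  counting_fun A theta n x = (cnt dlist L proj pmin pmax n x)%:R.
Proof.
rewrite /counting_fun /cnt natr_sum -(perm_big _ (code_words n)) big_map big_enum.
apply: eq_bigr => w _; rewrite indicE; congr (nat_of_bool _)%:R.
by apply/idP/idP; [move=> /set_mem/shadowP | move=> /shadowP/mem_set].
Qed.

Local Notation cmx := (cmax dlist L proj pmin pmax).

Lemma counting_fun_max N n x : (1 <= n <= N)%N ->
  counting_fun A theta n x <= counting_max A theta N x.
Proof.
move=> nN; apply: (le_bigmax_seq 0 n predT (fun n => counting_fun A theta n x)) => //.
by rewrite mem_index_iota ltnS.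
Qed.

Lemma counting_max_le N x : counting_max A theta N x <= (cmx N x)%:R.
Proof.
rewrite /counting_max big_seq; apply: bigmax_le => // n.
rewrite mem_index_iota ltnS => /andP[_ nN].
by rewrite counting_funE ler_nat cnt_cmax.
Qed.

Lemma measurable_counting_fun n : measurable_fun [set: R] (counting_fun A theta n).
Proof.
rewrite (_ : counting_fun A theta n = fun x => (cnt dlist L proj pmin pmax n x)%:R).
  exact: measurable_cnt.
by apply/funext => x; exact: counting_funE.
Qed.

Lemma measurable_counting_max N : measurable_fun [set: R] (counting_max A theta N).
Proof.
rewrite /counting_max; elim: (index_iota 1 N.+1) => [|n s IH].
  by under eq_fun do rewrite big_nil; exact: measurable_cst.
under eq_fun do rewrite big_cons.
by apply: measurable_maxr => //; exact: measurable_counting_fun.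
Qed.

(** Only [cmax] includes level 0, where the single empty word gives a count of at most 1; k > 1
    rules this level out. *)
Lemma counting_max_ge N k x : (1 < k)%N -> (k <= cmx N x)%N ->
  k%:R <= counting_max A theta N x.
Proof.
move=> k1; have [n nN ->] := cmax_cnt dlist L proj pmin pmax N x => kn.
apply: le_trans (_ : (cnt dlist L proj pmin pmax n x)%:R <= _).
  by rewrite ler_nat.
rewrite -counting_funE; apply: counting_fun_max; rewrite nN andbT lt0n.
apply: contraTneq kn => ->; rewrite -ltnNge /cnt big_seq1.
by apply: leq_ltn_trans k1; case: in_shadow.
Qed.

Lemma L2norm_le N (f : R -> R) : measurable_fun [set: R] f ->
  (forall x, 0 <= f x <= (cmx N x)%:R) ->
  (L2norm f ^+ 2 <= energy dlist L proj pmin pmax N)%E.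
Proof.
move=> mf fc.
have -> : (L2norm f ^+ 2 = \int[lebesgue_measure]_x ((f x) ^+ 2)%:E)%E.
  have n0 : (0 <= L2norm f)%E by exact: Lnorm_ge0.
  have -> : (L2norm f ^+ 2 = L2norm f `^ 2)%E.
    rewrite expe2; case: (L2norm f) n0 => [r| |]//.
      by rewrite lee_fin => r0; rewrite poweR_EFin powR_mulrn// -EFinM expr2.
    by rewrite poweRyr ?mulyy.
  rewrite poweR_Lnorm//; apply: eq_integral => x _ /=.
  by rewrite powR_mulrn// real_normK ?num_real.
apply: ge0_le_integral; [exact: measurableT| | | |].
- by move=> x _; rewrite lee_fin sqr_ge0.
- by apply/measurable_EFinP; exact: measurable_funX.
- apply/measurable_EFinP; under eq_fun do rewrite natrX.
  by apply: measurable_funX; exact: measurable_cmax.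
- move=> x _; rewrite lee_fin natrX; have := fc x => /andP[f0 fl].
  by rewrite lerXn2r ?nnegrE.
Qed.

End Bridge.

(** * Choice of the constants and absorption *)

Theorem theorem7p8 (R : realType) (d L : nat) (rho : R)
    (hd : (2 <= d)%N) (hL : (3 <= L)%N) (hrho : 2 < rho) :
  exists K0 C : R,
    forall (A : 'I_d -> {set 'I_L}) (theta : 'rV[R]_d) (N : nat) (K : R),
      (\prod_(i < d) #|A i|)%N = L ->
      sphere theta ->
      (1 <= N)%N ->
      K0 <= K ->
      (hausdorff1 [set x : R | (K <= counting_max A theta N x)%R]
         <= (K `^ (- rho))%:E)%E ->
      (L2norm (counting_max A theta N) ^+ 2 <= (C * K)%:E)%E /\
      (\big[maxe/0]_(1 <= n < N.+1) L2norm (counting_fun A theta n) ^+ 2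
         <= (C * K)%:E)%E.
Proof.
(* With T <= 34 K and M = 2 K^(-rho), the coefficient 30 T^2 M L^2 of the energy is at most (a / 2)
   K^(2 - rho), hence at most 1/2 once K^(rho - 2) >= a. *)
pose a : R := 120 * 34 ^+ 2 * L%:R ^+ 2.
pose K0 : R := Num.max 1 (a `^ (rho - 2)^-1).
exists K0, (48 * 34 * d%:R + 6) => A theta N K cardA theta1 N1 K0K hK.
have K1 : 1 <= K by apply: le_trans K0K; rewrite le_max lexx.
have L0 : 0 < L%:R :> R by rewrite ltr0n (leq_trans _ hL).
have L2 : 1 <= L%:R ^+ 2 :> R by rewrite exprn_ege1// ler1n (leq_trans _ hL).
have [cw wd] := andP (pwidth theta1).
set c := pmin theta in cw wd *; set e := pmax theta in cw wd *.
have ce : c < e by exact: pmin_lt_pmax.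
have aK : a <= K `^ (rho - 2).
  have a0 : 0 <= a by rewrite /a; nra.
  have r0 : 0 < rho - 2 by lra.
  have -> : a = (a `^ (rho - 2)^-1) `^ (rho - 2).
    by rewrite -powRrM mulVf ?powRr1// gt_eqF.
  apply: ge0_ler_powR; rewrite ?nnegrE ?powR_ge0//; [exact: ltW|lra|].
  by apply: le_trans K0K; rewrite le_max lexx orbT.
(* The factor 2 comes from comparing Lebesgue with Hausdorff measure. *)
set M : R := 2 * K `^ (- rho).
have KM : 2 * a * (K ^+ 2 * M) <= 4 .
  have : K ^+ 2 * K `^ (- rho) * K `^ (rho - 2) = 1.
    rewrite -powR_mulrn; last lra.
    rewrite -!powRD; try by apply/implyP => _; rewrite gt_eqF//; lra.
    by rewrite (_ : 2%:R - rho + (rho - 2) = 0) ?powRr0//; ring.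
  have : 0 <= K ^+ 2 * K `^ (- rho) by rewrite mulr_ge0 ?powR_ge0// sqr_ge0.
  rewrite /M; nra.
(* An integer with K < k <= 2K, and k >= 2 because K >= 1. *)
pose k := (Num.truncn K).+1.
have /andP[kK Kk] := truncn_itv (le_trans ler01 K1).
have k2 : (1 < k)%N by rewrite ltnS truncn_gt0.
have kle : k%:R <= 2 * K by rewrite /k -natr1 mulr2n mulrDl mul1r lerD.
pose F := fine (energy (dlist A) L (proj theta) c e N).
have FE : energy (dlist A) L (proj theta) c e N = F%:E.
  rewrite fineK//; apply: energy_fin => //.
  - exact: size_dlist.
  - by rewrite (leq_trans _ hL).
  - by move=> a' _; exact: proj_bound.
have F0 : 0 <= F by apply: fine_ge0; apply: integral_ge0 => x _; rewrite lee_fin.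
have lev : (lebesgue_measure (level (dlist A) L (proj theta) c e N k) <= M%:E)%E.
  have sub : level (dlist A) L (proj theta) c e N k `<=`
      [set x : R | K <= counting_max A theta N x].
    move=> x kx; apply: le_trans (ltW Kk) _.
    exact: counting_max_ge kx.
  apply: le_trans (lebesgue_le_hausdorff1 (measurable_level _ _ _ _ _ _ _) sub) _.
  by rewrite /M EFinM; apply: lee_wpmul2l; rewrite ?lee_fin.
have FC : F <= (48 * 34 * d%:R + 6) * K.
  have L1 : (1 < L)%N by rewrite (leq_trans _ hL).
  have := energy_le (size_dlist cardA) L1 ce (fun a' _ => proj_bound theta a')
    (ltnW k2) (erefl (17 * k)%N) lev.
  rewrite -/F natrM => FT.
  have T0 : 0 <= 17 * k%:R :> R by rewrite mulr_ge0.
  have T34 : 17 * k%:R <= 34 * K by lra.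
  have M0 : 0 <= M by rewrite mulr_ge0 ?powR_ge0.
  set T := 17 * k%:R in FT T0 T34.
  have TT : T ^+ 2 <= 34 ^+ 2 * K ^+ 2.
    by rewrite -exprMn lerXn2r ?nnegrE//; lra.
  pose X := 30 * T ^+ 2 * M.
  have X0 : 0 <= X.
    rewrite /X; apply: mulr_ge0; last exact: M0.
    by apply: mulr_ge0; [exact: ler0n|exact: sqr_ge0].
  have XL : X * L%:R ^+ 2 <= 2^-1.
    apply: le_trans (_ : 30 * (34 ^+ 2 * K ^+ 2) * M * L%:R ^+ 2 <= _).
      by rewrite ler_wpM2r// ler_wpM2r// ler_wpM2l.
    move: KM; rewrite /a; set Z := L%:R ^+ 2.
    rewrite (_ : 30 * (34 ^+ 2 * K ^+ 2) * M * Z =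
      8^-1 * (2 * (120 * 34 ^+ 2 * Z) * (K ^+ 2 * M))).
      by move=> H; lra.
    by field.
  have Xh : X <= 2^-1.
    by apply: le_trans XL; rewrite ler_peMr.
  have LF : L%:R ^+ 2 / (e - c) * F <= L%:R ^+ 2 * F.
    by rewrite ler_wpM2r// ler_pdivrMr ?ler_peMr//; lra.
  have X1 : X * (6 + L%:R ^+ 2 / (e - c) * F) <= 3 + 2^-1 * F.
    apply: le_trans (_ : X * 6 + X * (L%:R ^+ 2 * F) <= _).
      by rewrite mulrDr lerD2l ler_wpM2l.
    by rewrite mulrA; apply: lerD; [lra|exact: ler_wpM2r].
  have Y1 : 24 * (e - c) * T <= 24 * d%:R * (34 * K).
    by apply: ler_pM => //; [lra|rewrite ler_pM2l].
  (* This reads F <= 24 * 34 d K + 3 + F / 2; absorbing F / 2 and using K >= 1 gives the constant 48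
     * 34 d + 6. *)
  move: FT; rewrite -/X => FT; lra.
have main (f : R -> R) : measurable_fun [set: R] f ->
    (forall x, 0 <= f x <= (cmax (dlist A) L (proj theta) c e N x)%:R) ->
    (L2norm f ^+ 2 <= ((48 * 34 * d%:R + 6) * K)%:E)%E.
  move=> mf fc; apply: le_trans (L2norm_le mf fc) _.
  by rewrite FE lee_fin.
have fun0 n x : 0 <= counting_fun A theta n x by rewrite counting_funE.
split.
  apply: main => [|x]; first exact: measurable_counting_max.
  apply/andP; split; last exact: counting_max_le.
  by apply: le_trans (fun0 1%N x) _; apply: counting_fun_max; rewrite N1.
rewrite big_seq; apply: bigmax_le => [|n].
  by rewrite lee_fin mulr_ge0 ?addr_ge0 ?mulr_ge0//; lra.
rewrite mem_index_iota ltnS => nN; apply: main => [|x].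
  exact: measurable_counting_fun.
rewrite fun0; apply: le_trans (counting_fun_max _ _ _ nN) _.
exact: counting_max_le.
Qed.
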